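(* There exist two planar graphs together with a bijection between their vertex sets (equivalently, two planar graphs $G_1 = (V, E_1)$ and $G_2 = (V, E_2)$ on the same finite vertex set $V$) that cannot be simultaneously embedded with this mapping, i.e. that have no $2$-layer geometric embedding.
   Context: Graphs are finite and simple. Let $G_i = (V, E_i)$, $1 \le i \le k$, be $k$ graphs on the same vertex set $V$ with possibly different edge sets (a given mapping between the vertex sets is used to identify them). A $k$-layer geometric embedding (also called a simultaneous geometric embedding with mapping) of $G_1,\dots,G_k$ is an injective map $\phi : V \to \mathbb{R}^2$ such that, when every edge $uv$ is drawn as the straight segment $\overline{\phi(u)\phi(v)}$, for each $i$ the resulting drawing of $G_i$ is plane: two distinct edges of the same $E_i$ meet only at a common endpoint, and no edge of $E_i$ passes through the image of a vertex that is not one of its endpoints. Edges that do not both lie in a common $E_i$ may cross. *)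

(* Defs.v *)
(* MathComp-Analysis. *)
From mathcomp Require Import all_boot all_order all_algebra.
From mathcomp Require Import all_classical all_reals all_analysis.
Set Implicit Arguments.
Unset Strict Implicit.
Unset Printing Implicit Defensive.
Import Order.TTheory GRing.Theory Num.Theory numFieldNormedType.Exports.

Local Open Scope classical_set_scope.
Local Open Scope ring_scope.

Record sgraph (V : finType) := SGraph {
  adj : rel V;
  adj_sym : symmetric adj;
  adj_irr : irreflexive adj }.

Definition is_arc (R : realType) (p q : R * R) (C : set (R * R)) : Prop :=
  exists c : R -> R * R,
    [/\ {within `[0, 1], continuous c},
        {in `[0, 1] &, injective c},
        c 0 = p, c 1 = q & C = c @` `[0, 1]].

Definition segment (R : realType) (p q : R * R) : set (R * R) :=
  [set (1 - t) *: p + t *: q | t in `[0, 1]].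

(* [C u v] is the curve that draws the edge [uv]; it is irrelevant when [u] and
   [v] are not adjacent.  An edge is unordered, so [C u v] and [C v u] have to
   agree, and two edges are distinct when their sets of endpoints are. *)
Definition plane_drawing (R : realType) (V : finType) (G : sgraph V)
    (phi : V -> R * R) (C : V -> V -> set (R * R)) : Prop :=
  [/\ forall u v, adj G u v -> is_arc (phi u) (phi v) (C u v) /\ C u v = C v u,
      forall u v, adj G u v -> C u v `&` range phi `<=` phi @` [set u; v] &
      forall u v x y, adj G u v -> adj G x y -> [set u; v] <> [set x; y] ->
        C u v `&` C x y `<=` phi @` ([set u; v] `&` [set x; y])].

(* Planarity is the topological notion: edges are arbitrary arcs. *)
Definition planar (R : realType) (V : finType) (G : sgraph V) : Prop :=
  exists (phi : V -> R * R) (C : V -> V -> set (R * R)),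
    injective phi /\ plane_drawing G phi C.

Definition layered_embedding (R : realType) (V : finType) (k : nat)
    (Gs : k.-tuple (sgraph V)) (phi : V -> R * R) : Prop :=
  injective phi /\
  forall i : 'I_k,
    plane_drawing (tnth Gs i) phi (fun u v => segment (phi u) (phi v)).

(* Main.v *)
(** Let G1 be K5 minus an edge and G2 that edge together with the triangle on
    the other three vertices.  Both are planar, but any two disjoint edges of K5
    lie in a common Gi, and so does every single edge; hence a 2-layer geometric
    embedding would be a plane straight-line drawing of K5.  In such a drawing
    no three vertices are collinear, since the middle one would lie on the edge
    between the other two; but among five points in general position four are
    in convex position, and then the diagonals of their hull cross. *)

Require Import Defs.
From mathcomp Require Import all_boot all_order all_algebra.
From mathcomp Require Import all_classical all_reals all_analysis.
From mathcomp Require Import lra.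

Set Implicit Arguments.
Unset Strict Implicit.
Unset Printing Implicit Defensive.
Import Order.TTheory GRing.Theory Num.Theory numFieldNormedType.Exports.

Local Open Scope classical_set_scope.
Local Open Scope ring_scope.

(** * Orientation of triples and intersection of segments *)

(** Twice the signed area of the triangle [a b c]. Allowing any ring lets the same formula be
    evaluated on integer points. *)
Definition orient (R : pzRingType) (a b c : R * R) : R :=
  (b.1 - a.1) * (c.2 - a.2) - (b.2 - a.2) * (c.1 - a.1).

Lemma orient_cycle (R : realDomainType) (a b c : R * R) :
  orient b c a = orient a b c.
Proof. by rewrite /orient; lra. Qed.

Lemma orient_swap (R : realDomainType) (a b c : R * R) :
  orient a c b = - orient a b c.
Proof. by rewrite /orient; lra. Qed.


Lemma segmentP (R : realType) (p q x : R * R) :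
  segment p q x <-> exists t, [/\ 0 <= t, t <= 1,
    x.1 = (1 - t) * p.1 + t * q.1 & x.2 = (1 - t) * p.2 + t * q.2].
Proof.
split=> [[t /=]|[t [t0 t1 x1 x2]]].
  by rewrite in_itv /= => /andP[t0 t1] <-; exists t.
exists t; first by rewrite /= in_itv /= t0 t1.
by case: x x1 x2 => x1 x2 /= -> ->.
Qed.

Lemma segmentC (R : realType) (p q : R * R) : segment p q = segment q p.
Proof.
by apply/seteqP; split=> x /segmentP[t [t0 t1 x1 x2]]; apply/segmentP;
  exists (1 - t); split; lra.
Qed.

Lemma segment_is_arc (R : realType) (p q : R * R) :
  p != q -> is_arc p q (segment p q).
Proof.
move=> pq; exists (fun t => (1 - t) *: p + t *: q); split=> //.
- apply: continuous_subspaceT => t.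
  apply: cvgD; apply: cvgZr_tmp => //; apply: cvgB => //; exact: cvg_cst.
- move=> s t _ _ [e1 e2]; apply/eqP; rewrite -subr_eq0.
  apply: contraNT pq => st.
  have e3 : (s - t) * (q.1 - p.1) = 0.
    by move: e1 => /=; rewrite /GRing.scale /=; lra.
  have e4 : (s - t) * (q.2 - p.2) = 0.
    by move: e2 => /=; rewrite /GRing.scale /=; lra.
  move/eqP: e3; move/eqP: e4; rewrite !mulf_eq0 (negbTE st) /= !subr_eq0.
  move=> /eqP q2 /eqP q1.
  by rewrite [p]surjective_pairing [q]surjective_pairing q1 q2.
- by rewrite subr0 scale1r scale0r addr0.
- by rewrite subrr scale1r scale0r add0r.
Qed.

Lemma orient_segment (R : realType) (a b c : R * R) :
  segment a b c -> orient a b c = 0.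
Proof. by move=> /segmentP[t [_ _ c1 c2]]; rewrite /orient c1 c2; lra. Qed.

(** If [a] and [b] differ, [c] has a parameter [t] on their line; whether [t < 0], [0 <= t <= 1] or
    [t > 1] decides which point is the middle one. *)
Lemma orient0_segment (R : realType) (a b c : R * R) : orient a b c = 0 ->
  [\/ segment a b c, segment b c a | segment c a b].
Proof.
move=> abc0.
have [ab|ab] := eqVneq a b.
  by apply: Or32; apply/segmentP; exists 0; rewrite ab; split; lra.
have [t c1 c2] : exists2 t, c.1 = (1 - t) * a.1 + t * b.1
                         & c.2 = (1 - t) * a.2 + t * b.2.
  (* The parameter is read off from a coordinate in which [a] and [b] differ. *)
  have [e1|e1] := eqVneq (b.1 - a.1) 0.
    have e2 : b.2 - a.2 != 0.
      apply: contra ab => /eqP e.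
      rewrite [a]surjective_pairing [b]surjective_pairing.
      by apply/eqP; congr (_, _); lra.
    exists ((c.2 - a.2) / (b.2 - a.2)).
    + have : (b.2 - a.2) * (c.1 - a.1) = 0.
        by move: abc0; rewrite /orient e1; lra.
      move=> /eqP; rewrite mulf_eq0 (negbTE e2) /= subr_eq0 => /eqP ->.
      by have /eqP := e1; rewrite subr_eq0 => /eqP ->; lra.
    + by have := divfK e2 (c.2 - a.2); set u := _ / _ => hu; lra.
  exists ((c.1 - a.1) / (b.1 - a.1)).
    by have := divfK e1 (c.1 - a.1); set u := _ / _ => hu; lra.
  apply: (mulfI e1); move: (divfK e1 (c.1 - a.1)) abc0; rewrite /orient.
  set u := _ / _ => hu.
  have := congr1 (fun z => z * (b.2 - a.2)) hu; rewrite /=; lra.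
have [t0|t0] := ltP t 0.
  apply: Or32; apply/segmentP; exists (1 - t)^-1.
  have : 0 < (1 - t)^-1 by rewrite invr_gt0; lra.
  have : (1 - t)^-1 * (1 - t) = 1 by rewrite mulVf //; lra.
  move: (1 - t)^-1 => u h u0.
  have ut : u * t = u - 1 by lra.
  have ut0 : u * t < 0 by rewrite pmulr_rlt0.
  by split; [lra | lra | rewrite c1 | rewrite c2];
    rewrite mulrDr !mulrA h ut; lra.
have [t1|t1] := leP t 1; first by apply: Or31; apply/segmentP; exists t.
apply: Or33; apply/segmentP; exists (1 - t^-1).
have : 0 < t^-1 by rewrite invr_gt0; lra.
have : t^-1 * t = 1 by rewrite mulVf //; lra.
move: t^-1 => u h u0.
have ut : u * (1 - t) = u - 1 by lra.
have ut0 : 0 < u * (t - 1) by rewrite pmulr_rgt0 // subr_gt0.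
by split; [lra | lra | rewrite c1 | rewrite c2];
  rewrite subKr mulrDr !mulrA h ut; lra.
Qed.

(** An affine function with values [x] and [y] of opposite signs at the ends of a segment vanishes
    at parameter [x / (x - y)]. This gives where each segment meets the line of the other, and the
    two points agree. *)
Lemma segment_crossing (R : realType) (a b c d : R * R) :
  orient a b c * orient a b d < 0 -> orient c d a * orient c d b < 0 ->
  exists2 x, segment a b x & segment c d x.
Proof.
move=> abcd cdab.
have opposite_sub (x y : R) : x * y < 0 ->
    [/\ x - y != 0, 0 <= x / (x - y) & x / (x - y) <= 1].
  move=> xy; have xy0 : x - y != 0 by apply/eqP => e; nra.
  have h := divfK xy0 x; move: h; set u := _ / _ => h.
  by split=> //; have [x0|x0] := ltP 0 x; nra.
have [n0 s0 s1] := opposite_sub _ _ abcd.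
have [m0 t0 t1] := opposite_sub _ _ cdab.
have := divfK n0 (orient a b c); have := divfK m0 (orient c d a).
move: s0 s1 t0 t1; set s := _ / (orient a b c - _); set t := _ / _.
move=> s0 s1 t0 t1 ht hs.
exists ((1 - t) * a.1 + t * b.1, (1 - t) * a.2 + t * b.2).
  by apply/segmentP; exists t.
(* The denominators of [s] and [t] are opposite, so multiplying by one of them clears both. *)
apply/segmentP; exists s; split=> //=; apply: (mulfI n0).
- move: (congr1 (fun z => z * (b.1 - a.1)) ht) => /=.
  by move: (congr1 (fun z => z * (d.1 - c.1)) hs); rewrite /orient /=; lra.
- move: (congr1 (fun z => z * (b.2 - a.2)) ht) => /=.
  by move: (congr1 (fun z => z * (d.2 - c.2)) hs); rewrite /orient /=; lra.
Qed.

(** [orient a b] is affine, so it keeps its strict sign along [c d], whereas it vanishes on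
    [a b]. *)
Lemma segment_same_side (R : realType) (a b c d x : R * R) :
  0 < orient a b c * orient a b d -> segment a b x -> ~ segment c d x.
Proof.
move=> abcd /orient_segment abx /segmentP[t [t0 t1 x1 x2]].
have : (1 - t) * orient a b c + t * orient a b d = 0.
  by rewrite -abx /orient x1 x2; lra.
have [c0|c0] := ltP 0 (orient a b c).
  have d0 : 0 < orient a b d by rewrite -(pmulr_rgt0 _ c0).
  nra.
have c1 : orient a b c < 0.
  by rewrite lt_neqAle c0 andbT; apply/eqP => e; rewrite e mul0r ltxx in abcd.
have d0 : orient a b d < 0 by rewrite -(nmulr_rgt0 _ c1).
nra.
Qed.

(** At parameter [t] of the segment [a c], [orient a b] takes the value [t * orient a b c]; being on
    [a b] forces [t = 0]. *)
Lemma segment_common_endpoint (R : realType) (a b c x : R * R) :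
  orient a b c != 0 -> segment a b x -> segment a c x -> x = a.
Proof.
move=> abc /orient_segment abx /segmentP[t [_ _ x1 x2]].
have /eqP : t * orient a b c = 0 by rewrite -abx /orient x1 x2; lra.
rewrite mulf_eq0 (negbTE abc) orbF => /eqP t0.
by rewrite [x]surjective_pairing [a in RHS]surjective_pairing x1 x2 t0;
  congr (_, _); lra.
Qed.

(** * Certifying planarity by orientation signs *)

(** General position keeps vertices off foreign edges and handles edges with a common end; disjoint
    edges are apart because one lies strictly on one side of the line through the other. *)
Lemma straight_plane (R : realType) (V : finType) (G : sgraph V)
    (p : V -> R * R) :
  injective p ->
  (forall u v w, uniq [:: u; v; w] -> orient (p u) (p v) (p w) != 0) ->
  (forall u v x y, adj G u v -> adj G x y -> uniq [:: u; v; x; y] ->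
    0 < orient (p u) (p v) (p x) * orient (p u) (p v) (p y) \/
    0 < orient (p x) (p y) (p u) * orient (p x) (p y) (p v)) ->
  plane_drawing G p (fun u v => segment (p u) (p v)).
Proof.
move=> p_inj gp sep.
have adj_neq u v : adj G u v -> u != v.
  by move=> uv; apply: contraTneq uv => ->; rewrite adj_irr.
have meet u v y z : adj G u v -> adj G u y -> v <> y ->
    segment (p u) (p v) z -> segment (p u) (p y) z -> z = p u.
  move=> /adj_neq uv /adj_neq uy /eqP vy; apply: segment_common_endpoint.
  by apply: gp; rewrite /= !inE negb_or uv uy vy.
split.
- move=> u v /adj_neq uv; split; last exact: segmentC.
  by apply: segment_is_arc; rewrite (inj_eq p_inj).
- move=> u v /adj_neq uv _ [/[swap] -[w _ <-] /orient_segment uvw].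
  have [->|wu] := eqVneq w u; first by exists u => //; left.
  have [->|wv] := eqVneq w v; first by exists v => //; right.
  have := gp u v w; rewrite /= !inE negb_or uv !(eq_sym _ w) wu wv uvw eqxx.
  by move=> /(_ isT).
- move=> u v x y uv xy uvxy z [zuv zxy].
  have vu : adj G v u by rewrite adj_sym.
  have yx : adj G y x by rewrite adj_sym.
  have zvu : segment (p v) (p u) z by rewrite segmentC.
  have zyx : segment (p y) (p x) z by rewrite segmentC.
  (* In each of the four ways to share an endpoint, that endpoint is the only common point. *)
  have [ux|ux] := eqVneq u x.
    subst x; exists u; first by split; left.
    by apply/esym/(meet u v y) => // vy; apply: uvxy; rewrite vy.
  have [uy|uy] := eqVneq u y.
    subst y; exists u; first by split; [left|right].
    by apply/esym/(meet u v x) => // vx; apply: uvxy; rewrite vx setUC.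
  have [vx|vx] := eqVneq v x.
    subst x; exists v; first by split; [right|left].
    by apply/esym/(meet v u y) => // uy'; rewrite uy' eqxx in uy.
  have [vy|vy] := eqVneq v y.
    subst y; exists v; first by split; right.
    by apply/esym/(meet v u x) => // ux'; rewrite ux' eqxx in ux.
  exfalso; have [] := sep _ _ _ _ uv xy.
  + by rewrite /= !inE !negb_or (adj_neq _ _ uv) (adj_neq _ _ xy) ux uy vx vy.
  + by move=> /segment_same_side; apply; [exact: zuv|].
  + by move=> /segment_same_side; apply; [exact: zxy|].
Qed.

Definition int_point (R : realType) (a : int * int) : R * R :=
  (a.1%:~R, a.2%:~R).

Lemma orient_int_point (R : realType) (a b c : int * int) :
  orient (int_point R a) (int_point R b) (int_point R c) = (orient a b c)%:~R.
Proof. by rewrite /orient /= !(intrB, intrM). Qed.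

Lemma all_iota_ord (n : nat) (P : pred nat) :
  all P (iota 0 n) -> forall i : 'I_n, P i.
Proof. by move=> /allP H i; apply: H; rewrite mem_iota /=. Qed.

(* The coordinates are integers indexed by [nat], and the quantifiers range over
   lists, so that the condition can be decided by computation. *)
Definition general_position_drawing (n : nat) (e : rel nat)
    (c : nat -> int * int) : bool :=
  let I := iota 0 n in
  [&& all (fun u => all (fun v => (c u == c v) ==> (u == v)) I) I,
      all (fun u => all (fun v => all (fun w =>
        uniq [:: u; v; w] ==> (orient (c u) (c v) (c w) != 0)) I) I) I &
      all (fun u => all (fun v => all (fun x => all (fun y =>
        [&& e u v, e x y & uniq [:: u; v; x; y]] ==>
        (0 < orient (c u) (c v) (c x) * orient (c u) (c v) (c y))
        || (0 < orient (c x) (c y) (c u) * orient (c x) (c y) (c v)))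
      I) I) I) I].

(** The embedding of the integers into [R] preserves signs of orientations, so a check on integers
    suffices for every [R]. *)
Lemma general_position_planar (R : realType) (n : nat) (G : sgraph 'I_n)
    (e : rel nat) (c : nat -> int * int) :
  (forall u v, adj G u v = e u v) -> general_position_drawing n e c ->
  planar R G.
Proof.
move=> Ge /and3P[c_inj gp sep].
pose p (i : 'I_n) := int_point R (c i).
exists p, (fun u v => segment (p u) (p v)).
have p_inj : injective p.
  move=> u v [/eqP e1 /eqP e2]; apply/val_inj/eqP.
  have := all_iota_ord (all_iota_ord c_inj u) v.
  move: e1 e2; rewrite !eqr_int => e1 e2 /implyP; apply.
  by rewrite [c u]surjective_pairing [c v]surjective_pairing xpair_eqE e1 e2.
split=> //; apply: straight_plane => // [u v w uvw|u v x y uv xy uvxy].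
  rewrite orient_int_point intr_eq0.
  have /implyP := all_iota_ord (all_iota_ord (all_iota_ord gp u) v) w.
  by apply; rewrite -(map_inj_uniq val_inj) in uvw.
have /implyP :=
  all_iota_ord (all_iota_ord (all_iota_ord (all_iota_ord sep u) v) x) y.
rewrite -!Ge uv xy; rewrite -(map_inj_uniq val_inj) in uvxy.
rewrite !orient_int_point -!intrM !ltr0z => /(_ uvxy).
exact: orP.
Qed.

(** * No plane straight-line drawing of K5 *)

(** If both alternatives fail, all orientations are nonzero and every four points avoid the sign
    patterns of a crossing. A finite search over signs then takes the place of the convex position
    argument. *)
Lemma K5_not_straight (R : realType) (p : 'I_5 -> R * R) :
  (exists u v w, uniq [:: u; v; w] /\ segment (p u) (p v) (p w)) \/
  (exists u v x y z, [/\ uniq [:: u; v; x; y],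
    segment (p u) (p v) z & segment (p x) (p y) z]).
Proof.
case: (pselect (exists u v w, uniq [:: u; v; w] /\ segment (p u) (p v) (p w))).
  by left.
move=> no_collinear; right; apply: contrapT => no_crossing.
have gp u v w : uniq [:: u; v; w] -> orient (p u) (p v) (p w) != 0.
  move=> uvw; apply/eqP => /orient0_segment H; apply: no_collinear.
  case: H => H; [exists u, v, w|exists v, w, u|exists w, u, v]; split=> //.
  - by rewrite -(rot_uniq 2).
  - by rewrite -(rot_uniq 1).
pose s u v w := 0 < orient (p u) (p v) (p w).
have mulP (x y : R) : x != 0 -> y != 0 -> (x * y < 0) = ((0 < x) != (0 < y)).
  move=> x0 y0; have [xp|xn] := ltP 0 x.
    by rewrite pmulr_rlt0 // -leNgt le_eqVlt (negbTE y0).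
  have {xn} xn : x < 0 by rewrite lt_neqAle x0.
  by rewrite nmulr_rlt0 //; case: (0 < y).
have mulP' (x y : R) : x != 0 -> y != 0 -> (0 < x * y) = ((0 < x) == (0 < y)).
  move=> x0 y0; rewrite -[RHS]negbK -mulP // -leNgt le_eqVlt eq_sym.
  by rewrite mulf_eq0 (negbTE x0) (negbTE y0).
(* The disjuncts are the crossings of [ab] with [cd], [ac] with [bd], and [ad] with [bc]. Only
   triples in the order of [a, b, c, d] are used; in the second case each product contains exactly
   one odd reordering, which turns [!=] into [==]. *)
have four a b c d : uniq [:: a; b; c; d] ->
  ~~ [|| (s a b c != s a b d) && (s a c d != s b c d),
         (s a b c == s a c d) && (s a b d == s b c d) |
         (s a b c != s b c d) && (s a b d != s a c d)].
  move=> abcd.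
  have : [&& a != b, a != c, a != d, b != c, b != d & c != d].
    by move: abcd; rewrite /= !inE !negb_or -!andbA andbT.
  move=> /and5P[ab ac ad bc /andP[bd cd]].
  have [abc abd acd bcd] : [/\ orient (p a) (p b) (p c) != 0,
      orient (p a) (p b) (p d) != 0, orient (p a) (p c) (p d) != 0 &
      orient (p b) (p c) (p d) != 0].
    by split; apply: gp; rewrite /= !inE !negb_or ?ab ?ac ?ad ?bc ?bd ?cd.
  have cross u v x y : uniq [:: u; v; x; y] ->
      orient (p u) (p v) (p x) * orient (p u) (p v) (p y) < 0 ->
      orient (p x) (p y) (p u) * orient (p x) (p y) (p v) < 0 -> False.
    move=> uvxy h1 h2; have [z z1 z2] := segment_crossing h1 h2.
    by apply: no_crossing; exists u, v, x, y, z.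
  apply/negP => /or3P[] /andP[]; rewrite /s.
  - rewrite -!mulP // => h1 h2; apply: (cross a b c d) => //.
    by rewrite (orient_cycle (p a)) (orient_cycle (p b)).
  - rewrite -!mulP' // => h1 h2; apply: (cross a c b d).
    + by rewrite /= !inE !negb_or ab ac ad bd cd (eq_sym c b) bc.
    + by rewrite (orient_swap (p a) (p b)) mulNr oppr_lt0.
    + by rewrite (orient_cycle (p a)) (orient_swap (p b) (p c)) mulrN oppr_lt0.
  - rewrite -!mulP // => h1 h2; apply: (cross a d b c).
    + by rewrite /= !inE !negb_or ab ac ad bc !(eq_sym d) bd cd.
    + by rewrite (orient_swap (p a) (p b) (p d)) (orient_swap (p a) (p c)) mulrNN.
    + by rewrite (orient_cycle (p a)).
(* No sign pattern on the ten triples avoids a crossing in all five four-sets;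
   not even the Grassmann-Pluecker relations are needed to exclude one. *)
pose o i (lt_i : (i < 5)%N) : 'I_5 := Ordinal lt_i.
have := four (@o 0%N isT) (@o 1%N isT) (@o 2 isT) (@o 3 isT) isT.
have := four (@o 0%N isT) (@o 1%N isT) (@o 2 isT) (@o 4 isT) isT.
have := four (@o 0%N isT) (@o 1%N isT) (@o 3 isT) (@o 4 isT) isT.
have := four (@o 0%N isT) (@o 2 isT) (@o 3 isT) (@o 4 isT) isT.
have := four (@o 1%N isT) (@o 2 isT) (@o 3 isT) (@o 4 isT) isT.
by do 10 case: (s _ _ _).
Qed.

(** * The two graphs and the conclusion *)

Definition ordinal_sgraph (n : nat) (e : rel nat) (e_sym : symmetric e)
    (e_irr : irreflexive e) : sgraph 'I_n :=
  @SGraph 'I_n (fun u v => e u v) (fun u v => e_sym u v) (fun u => e_irr u).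

(** On the vertices 0 to 4, the missing edge joins 3 and 4. *)
Definition K5_minus_edge : rel nat :=
  fun u v => (u != v) && ((u < 3) || (v < 3))%N.

Definition edge_and_triangle : rel nat :=
  fun u v => (u != v) && ((u < 3)%N == (v < 3)%N).

Lemma K5_minus_edge_sym : symmetric K5_minus_edge.
Proof. by move=> u v; rewrite /K5_minus_edge eq_sym orbC. Qed.

Lemma K5_minus_edge_irr : irreflexive K5_minus_edge.
Proof. by move=> u; rewrite /K5_minus_edge eqxx. Qed.

Lemma edge_and_triangle_sym : symmetric edge_and_triangle.
Proof.
move=> u v; rewrite /edge_and_triangle eq_sym.
by case: (u < 3)%N; case: (v < 3)%N.
Qed.

Lemma edge_and_triangle_irr : irreflexive edge_and_triangle.
Proof. by move=> u; rewrite /edge_and_triangle eqxx. Qed.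

(** If one of the edges is 34, the other lies in the triangle 012 and the second graph has both;
    otherwise the first graph has both. *)
Lemma disjoint_edges_covered (u v x y : 'I_5) :
  uniq [:: val u; val v; val x; val y] ->
  (K5_minus_edge u v && K5_minus_edge x y) ||
  (edge_and_triangle u v && edge_and_triangle x y).
Proof.
have H : all (fun u => all (fun v => all (fun x => all (fun y =>
    uniq [:: u; v; x; y] ==>
    (K5_minus_edge u v && K5_minus_edge x y) ||
    (edge_and_triangle u v && edge_and_triangle x y))
    (iota 0 5)) (iota 0 5)) (iota 0 5)) (iota 0 5) by vm_compute.
apply/implyP.
exact: (all_iota_ord (all_iota_ord (all_iota_ord (all_iota_ord H u) v) x) y).
Qed.

(** Vertex 4 is placed at the default value [a] of [nth]; vertex 3 lies inside the triangle 012. *)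
Definition five_points (a : int * int) (i : nat) : int * int :=
  nth a [:: (0, 0); (12, 0); (5, 5); (6, 2)] i.

Theorem theorem6 (R : realType) :
  exists (V : finType) (G1 G2 : sgraph V),
    [/\ planar R G1, planar R G2 &
        ~ exists phi : V -> R * R, layered_embedding [tuple G1; G2] phi].
Proof.
exists 'I_5, (ordinal_sgraph 5 K5_minus_edge_sym K5_minus_edge_irr).
exists (ordinal_sgraph 5 edge_and_triangle_sym edge_and_triangle_irr).
split.
(* Vertex 4 is outside the triangle 012, placed so that vertex 2 lies inside the triangle 014. *)
- apply: (@general_position_planar R 5 _ K5_minus_edge
    (five_points (5, 12))) => [//|]; by vm_compute.
(* Here vertex 4 joins vertex 3 inside the triangle 012, so the edge 34 stays in its interior. *)
- apply: (@general_position_planar R 5 _ edge_and_triangle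
    (five_points (4, 1))) => [//|]; by vm_compute.
move=> [p [p_inj emb]].
have [_ vertex1 cross1] := emb ord0; have [_ vertex2 cross2] := emb ord_max.
have [[u [v [w [uvw puvw]]]]|[u [v [x [y [z [uvxy zuv zxy]]]]]]] :=
  K5_not_straight p.
- have wuv : ~ (p @` [set u; v]) (p w).
    move: uvw; rewrite /= !inE negb_or => /and3P[/andP[_ uw] vw _].
    by move=> [_ [->|->] /p_inj e]; rewrite e eqxx in uw vw.
  have pw : range p (p w) by exists w.
  have uv : val u != val v.
    by move: uvw; rewrite /= inE negb_or => /andP[/andP[]].
  (* The edge [uv] belongs to one of the layers, whose vertex condition makes [w] an endpoint of
     it. *)
  apply: wuv; case: (boolP (K5_minus_edge u v)) => [uv1|uv1].
    exact: (vertex1 u v).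
  apply: (vertex2 u v) => //; move: uv1.
  rewrite /K5_minus_edge /edge_and_triangle /= uv.
  by case: (u < 3)%N; case: (v < 3)%N.
- have disj : ~ (p @` ([set u; v] `&` [set x; y])) z.
    move: uvxy; rewrite /= !inE !negb_or -!andbA.
    move=> /and5P[uv ux uy vx /and3P[vy xy _]].
    move=> [t [[->|->] [/eqP|/eqP]]];
      by rewrite ?(negbTE ux) ?(negbTE uy) ?(negbTE vx) ?(negbTE vy).
  have ne : [set u; v] <> [set x; y].
    move=> e; have : [set x; y] u by rewrite -e; left.
    move: uvxy; rewrite /= !inE !negb_or -!andbA => /and5P[uv ux uy _ _].
    by case=> /eqP; rewrite ?(negbTE ux) ?(negbTE uy).
  (* The layer containing both edges would put [z] in the image of their common endpoints, of which
     there are none. *)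
  apply: disj.
  rewrite -(map_inj_uniq val_inj) in uvxy.
  by case/orP: (disjoint_edges_covered uvxy) => /andP[uv xy];
    [apply: cross1 uv xy ne _ _|apply: cross2 uv xy ne _ _].
Qed.
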